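(* Let $\mathcal{X}\subseteq\mathbb{R}^N$ and $\mathcal{Z}_m\subseteq\mathbb{R}^{J_m}$, $m\in[M]$, be non-empty, compact and convex. Let $f_0:\mathbb{R}^N\to\mathbb{R}\cup\{+\infty\}$ be convex with $\mathcal{X}\subseteq\mathrm{dom}(f_0)$, and let $g_m:\mathbb{R}^N\times\mathbb{R}^{J_m}\to\mathbb{R}\cup\{\pm\infty\}$, $m\in[M]$, be such that $g_m(\cdot,z_m)$ is convex on $\mathbb{R}^N$ for every $z_m\in\mathcal{Z}_m$, $g_m(x,\cdot)$ is concave on $\mathbb{R}^{J_m}$ for every $x\in\mathcal{X}$, and $\mathcal{X}\times\mathcal{Z}_m\subseteq\mathrm{dom}(g_m)$. Put $f_m(x)=\max_{z_m\in\mathcal{Z}_m}g_m(x,z_m)$. Assume there is $\bar x\in\mathcal{X}$ with $f_m(\bar x)<0$ for all $m\in[M]$, and that the problem $\min\{f_0(x): x\in\mathcal{X},\ f_m(x)\le 0\ \forall m\in[M]\}$ has an optimal solution $x^\star$. Assume further that $f_0$ is subdifferentiable on $\mathcal{X}$; that for all $m\in[M]$, $x\in\mathcal{X}$, $z_m\in\mathcal{Z}_m$ the functions $g_m(\cdot,z_m)$ and $-g_m(x,\cdot)$ are subdifferentiable on $\mathcal{X}$ and $\mathcal{Z}_m$, respectively; and that there are constants $D_0,D_1,\dots,D_M,E_1,\dots,E_M>0$ such that for all $m\in[M]$, $x\in\mathcal{X}$, $z_m\in\mathcal{Z}_m$: $\|\xi_0\|_2\le D_0$ for all $\xi_0\in\partial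 f_0(x)$, $\|\xi_m\|_2\le D_m$ for all $\xi_m\in\partial_x g_m(x,z_m)$, and $\|\zeta_m\|_2\le E_m$ for all $\zeta_m\in\partial_{z_m}(-g_m)(x,z_m)$. Consider the Outer Algorithm (described in the context) with $\theta=\nu=\frac1K$, $0<\alpha\le\frac{1}{\sqrt{\sum_{m\in[M]}D_m^2}}$ and $0<\beta\le\frac{1}{2\sqrt{\sum_{m\in[M]}D_m^2}}$. Then its output $\bar x^K$ satisfies $$f_0(\bar x^K)-f_0(x^\star)\le\frac{C_{o,1}}{K}\quad\text{and}\quad\max_{m\in[M]}[f_m(\bar x^K)]_+\le\frac{C_{o,2}}{K}$$ for some constants $C_{o,1},C_{o,2}>0$ (independent of $K$).
   Context: Notation: $[M]=\{1,\dots,M\}$; $[a]_+=\max\{a,0\}$ (componentwise for vectors); $\mathcal{Z}=\mathcal{Z}_1\times\cdots\times\mathcal{Z}_M$; $g(x,z)=(g_1(x,z_1),\dots,g_M(x,z_M))$; $\mathrm{dom}$ denotes the set where a function is finite. A function is subdifferentiable at a point if its set of subgradients there is non-empty. Strong approximate saddle point: let $\mathcal{F}:\mathcal{U}\times\mathcal{V}\to\mathbb{R}$ be $\sigma$-strongly convex in $u$ for each $v$ ($\sigma>0$ independent of $v$) and concave in $v$ for each $u$. For $\nu>0$, $(\tilde u,\tilde v)\in\mathcal{U}\times\mathcal{V}$ is a strong $\nu$-approximate saddle point of $\mathcal{F}$ if $\mathcal{F}(\tilde u,v)\le\mathcal{F}(u,\tilde v)-\frac{\sigma}{2}\|u-\tilde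 u\|_2^2+\nu$ for all $(u,v)\in\mathcal{U}\times\mathcal{V}$. Outer Algorithm. Input: $K\ge1$, $\theta,\nu,\alpha,\beta>0$, $\lambda^0=0\in\mathbb{R}^M$, $x^0\in\mathcal{X}$. For $k=0,1,\dots,K-1$: (λ-update) for each $m\in[M]$ find any $z_m^k\in\mathcal{Z}_m$ with $f_m(x^k)-g_m(x^k,z_m^k)\le\theta$, and set $\lambda^{k+1}=[\lambda^k+\beta(2g(x^k,z^k)-g(x^{k-1},z^{k-1}))]_+$, where $x^{-1}=x^0$, $z^{-1}=z^0$; (x-update) let $(x^{k+1},\tilde z^{k+1})\in\mathcal{X}\times\mathcal{Z}$ be any strong $\nu$-approximate saddle point (with $\sigma=1/\alpha$) of $\min_{x\in\mathcal{X}}\max_{z\in\mathcal{Z}}\{f_0(x)+\sum_{m\in[M]}\lambda_m^{k+1}g_m(x,z_m)+\frac{1}{2\alpha}\|x-x^k\|_2^2\}$. Output: $\bar x^K=\frac1K\sum_{k=1}^K x^k$. *)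

(* Defs.v *)
From mathcomp Require Import all_boot all_order all_algebra.
From mathcomp Require Import all_classical all_reals all_analysis.

Set Implicit Arguments.
Unset Strict Implicit.
Unset Printing Implicit Defensive.

Import Order.TTheory GRing.Theory Num.Theory.
Import numFieldNormedType.Exports.

Local Open Scope classical_set_scope.
Local Open Scope ring_scope.

Definition dot (R : realType) (n : nat) (u v : 'rV[R]_n) : R :=
  \sum_(i < n) u 0 i * v 0 i.

(* The library's norm on ['rV[R]_n] is the sup norm; it induces the same
   topology as this one. *)
Definition l2norm (R : realType) (n : nat) (u : 'rV[R]_n) : R :=
  Num.sqrt (dot u u).

(* Convexity through the epigraph, which makes sense for functions taking both
   infinite values. *)
Definition convex_efun (R : realType) (n : nat) (f : 'rV[R]_n -> \bar R) : Prop :=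
  convex_set [set p : 'rV[R]_n * R^o | (f p.1 <= (p.2 : R)%:E)%E].

Definition concave_efun (R : realType) (n : nat) (f : 'rV[R]_n -> \bar R) : Prop :=
  convex_efun (fun x => (- f x)%E).

(* Only used at points where [f] is finite; the inequality ranges over the whole
   space. *)
Definition subdiff (R : realType) (n : nat) (f : 'rV[R]_n -> \bar R)
    (x : 'rV[R]_n) : set 'rV[R]_n :=
  [set xi | forall y, (f x + (dot xi (y - x))%:E <= f y)%E].

(* [f_m] for [Z = Z_m] and [g = g_m]. When [Z] is compact and non-empty and
   [- g x] is finite and subdifferentiable on [Z], [g x] is upper semicontinuous
   on [Z], so the supremum is a maximum. *)
Definition maxval (R : realType) (n j : nat) (Z : set 'rV[R]_j)
    (g : 'rV[R]_n -> 'rV[R]_j -> \bar R) (x : 'rV[R]_n) : \bar R :=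
  ereal_sup [set g x z | z in Z].

Definition optimal_solution (R : realType) (N M : nat) (X : set 'rV[R]_N)
    (f0 : 'rV[R]_N -> \bar R) (f : 'I_M -> 'rV[R]_N -> \bar R)
    (xs : 'rV[R]_N) : Prop :=
  let feasible := [set x | X x /\ forall m, (f m x <= 0)%E] in
  feasible xs /\ forall x, feasible x -> (f0 xs <= f0 x)%E.

(* Meant for [F] that is [sigma]-strongly convex in its first argument and
   concave in its second; [prox_lagrangian] below is, with [sigma = alpha^-1]
   and [lam >= 0]. *)
Definition strong_approx_saddle (R : realType) (n : nat) (T : Type)
    (U : set 'rV[R]_n) (V : set T) (F : 'rV[R]_n -> T -> R) (sigma nu : R)
    (ut : 'rV[R]_n) (vt : T) : Prop :=
  [/\ U ut, V vt &
    forall u v, U u -> V v ->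
      F ut v <= F u vt - sigma / 2 * l2norm (u - ut) ^+ 2 + nu].

(* Objective of the x-update. It is only evaluated on [X * Z], where [f0] and
   the [g m] are finite. *)
Definition prox_lagrangian (R : realType) (N M : nat) (J : 'I_M -> nat)
    (f0 : 'rV[R]_N -> \bar R)
    (g : forall m, 'rV[R]_N -> 'rV[R]_(J m) -> \bar R)
    (alpha : R) (lam : 'rV[R]_M) (xk : 'rV[R]_N)
    (x : 'rV[R]_N) (z : forall m, 'rV[R]_(J m)) : R :=
  fine (f0 x) + \sum_(m < M) lam 0 m * fine (g m x (z m))
  + (2 * alpha)^-1 * l2norm (x - xk) ^+ 2.

(* [x], [z], [zt], [lam] are the iterates of a run with [K] iterations; their
   values beyond those produced by the algorithm are unconstrained. Since
   [0.-1 = 0], the index [k.-1] encodes x^{-1} = x^0 and z^{-1} = z^0. *)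
Record outer_run (R : realType) (N M : nat) (J : 'I_M -> nat)
    (X : set 'rV[R]_N) (Z : forall m, set 'rV[R]_(J m))
    (f0 : 'rV[R]_N -> \bar R)
    (g : forall m, 'rV[R]_N -> 'rV[R]_(J m) -> \bar R)
    (K : nat) (theta nu alpha beta : R)
    (x : nat -> 'rV[R]_N) (z zt : nat -> forall m, 'rV[R]_(J m))
    (lam : nat -> 'rV[R]_M) : Prop := OuterRun {
  run_lam0 : lam 0%N = 0 ;
  run_x0 : X (x 0%N) ;
  run_z : forall k m, (k < K)%N ->
    Z m (z k m) /\
    (maxval (Z m) (g m) (x k) - g m (x k) (z k m) <= theta%:E)%E ;
  run_lam : forall k, (k < K)%N ->
    lam k.+1 = \row_m Num.max 0
      (lam k 0 m + beta * (2 * fine (g m (x k) (z k m))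
                           - fine (g m (x k.-1) (z k.-1 m)))) ;
  run_x : forall k, (k < K)%N ->
    strong_approx_saddle X [set w | forall m, Z m (w m)]
      (prox_lagrangian f0 g alpha (lam k.+1) (x k))
      alpha^-1 nu (x k.+1) (zt k.+1)
}.

Definition outer_output (R : realType) (N K : nat) (x : nat -> 'rV[R]_N) :
    'rV[R]_N :=
  K%:R^-1 *: \sum_(1 <= k < K.+1) x k.

(* Main.v *)
(* Writing [G k] for the oracle values g(x^k, z^k), which lie in
   [f(x^k) - theta, f(x^k)], the saddle inequality of the x-update and the
   projection inequality of the lambda-update bound the Lagrangian gap
   f_0(x^{k+1}) + mu.f(x^{k+1}) - f_0(xs) for every mu >= 0 by telescoping terms
   plus (mu - lambda^{k+1}).(G^{k+1} - 2 G^k + G^{k-1}). The latter telescopes up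
   to (lambda^{k+1} - lambda^k).(G^k - G^{k-1}), which the quadratic terms absorb
   because f_m is D_m-Lipschitz on X and alpha, beta are small. Summing and
   using Jensen gives the rate 1/K for the Lagrangian at the average, for every
   fixed mu >= 0. Taking mu = 0 bounds the objective gap. For the constraints
   take mu = (rho + 1) e_m with m the most violated constraint and rho an
   exact-penalty constant obtained from the Slater point. *)

Require Import Defs.
From mathcomp Require Import all_boot all_order all_algebra.
From mathcomp Require Import all_classical all_reals all_analysis.
From mathcomp Require Import ring lra.
Import Order.TTheory GRing.Theory Num.Theory.
Import numFieldNormedType.Exports.
Local Open Scope classical_set_scope.
Local Open Scope ring_scope.

(** * Euclidean inner product and norm *)

Lemma dot_ge0 (R : realType) (n : nat) (u : 'rV[R]_n) : 0 <= dot u u.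
Proof. by apply: sumr_ge0 => i _; rewrite -expr2 sqr_ge0. Qed.

Lemma l2norm_ge0 (R : realType) (n : nat) (u : 'rV[R]_n) : 0 <= l2norm u.
Proof. exact: sqrtr_ge0. Qed.

Lemma sqr_l2norm (R : realType) (n : nat) (u : 'rV[R]_n) :
  l2norm u ^+ 2 = dot u u.
Proof. by rewrite sqr_sqrtr// dot_ge0. Qed.

Lemma l2norm0 (R : realType) (n : nat) : l2norm (0 : 'rV[R]_n) = 0.
Proof.
rewrite /l2norm /dot big1 ?sqrtr0// => i _.
by rewrite mxE mul0r.
Qed.

Lemma l2norm_sub (R : realType) (n : nat) (u v : 'rV[R]_n) :
  l2norm (u - v) = l2norm (v - u).
Proof.
congr Num.sqrt; apply: eq_bigr => i _.
by rewrite !mxE; ring.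
Qed.

Lemma l2norm_eq0 (R : realType) (n : nat) (u : 'rV[R]_n) :
  l2norm u = 0 -> u = 0.
Proof.
move=> /(congr1 (fun t => t ^+ 2)); rewrite sqr_l2norm expr0n /= => u0.
have := psumr_eq0P (fun i (_ : xpredT i) => sqr_ge0 (u 0 i)).
move=> H; apply/rowP => i; rewrite mxE; apply/eqP; rewrite -sqrf_eq0.
by apply/eqP; apply: H => //; rewrite -u0; apply: eq_bigr => j _; rewrite expr2.
Qed.

(** For nonzero norms, the squared length of [l2norm v *: u - l2norm u *: v] is a positive multiple
    of [l2norm u * l2norm v - dot u v]. *)
Lemma cauchy_schwarz (R : realType) (n : nat) (u v : 'rV[R]_n) :
  dot u v <= l2norm u * l2norm v.
Proof.
have [u0|u0] := eqVneq (l2norm u) 0.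
  rewrite u0 (l2norm_eq0 _ _ _ u0) mul0r /dot big1// => i _.
  by rewrite mxE mul0r.
have [v0|v0] := eqVneq (l2norm v) 0.
  rewrite v0 (l2norm_eq0 _ _ _ v0) mulr0 /dot big1// => i _.
  by rewrite mxE mulr0.
have a0 : 0 < l2norm u by rewrite lt_def u0 l2norm_ge0.
have b0 : 0 < l2norm v by rewrite lt_def v0 l2norm_ge0.
have := dot_ge0 _ _ (l2norm v *: u - l2norm u *: v).
have -> : dot (l2norm v *: u - l2norm u *: v) (l2norm v *: u - l2norm u *: v)
    = 2 * (l2norm u * l2norm v) * (l2norm u * l2norm v - dot u v).
  transitivity (l2norm v ^+ 2 * dot u u - 2 * (l2norm u * l2norm v) * dot u v
      + l2norm u ^+ 2 * dot v v).
    rewrite /dot !mulr_sumr -sumrB -big_split /=.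
    by apply: eq_bigr => i _; rewrite !mxE; ring.
  by rewrite -!sqr_l2norm; ring.
by rewrite pmulr_rge0 ?subr_ge0// !mulr_gt0.
Qed.

(** Compactness bounds the sup norm, hence every coordinate. The bound serves to make the rate
    uniform over the starting point. *)
Lemma compact_dist_bounded (R : realType) (n : nat) (X : set 'rV[R]_n)
    (y : 'rV[R]_n) : compact X ->
  exists2 B : R, 0 <= B & forall x, X x -> l2norm (y - x) ^+ 2 <= B.
Proof.
move=> /compact_bounded [C [_ hC]].
pose c := `|y| + (`|C| + 1).
have coord (v : 'rV[R]_n) i : `|v 0 i| <= `|v|.
  rewrite [leRHS]mx_normrE.
  exact: (le_bigmax _ (fun k : 'I_1 * 'I_n => `|v k.1 k.2|) (ord0, i)).
exists (\sum_(i < n) c ^+ 2); first by apply: sumr_ge0 => i _; rewrite sqr_ge0.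
move=> x Xx; rewrite sqr_l2norm; apply: ler_sum => i _.
rewrite -expr2 !mxE -real_normK ?num_real// ler_sqr ?nnegrE ?normr_ge0//; last first.
  by rewrite /c !addr_ge0.
apply: le_trans (ler_normB _ _) _; apply: lerD; first exact: coord.
apply: le_trans (coord _ _) _; apply: hC => //.
by rewrite (le_lt_trans (ler_norm C))// ltrDl.
Qed.

(** * Convexity and Jensen's inequality for averaged iterates *)

Lemma convex_set_comb (R : realType) (E : lmodType R) (A : set E) (x y : E)
    (t : R) : convex_set A -> A x -> A y -> 0 <= t <= 1 ->
  A (t *: x + (1 - t) *: y).
Proof.
move=> cA /mem_set Ax /mem_set Ay /andP[t0 t1].
by have /set_mem := cA x y (Itv01 t0 t1) Ax Ay.
Qed.

Lemma convex_efun_fine (R : realType) (n : nat) (f : 'rV[R]_n -> \bar R)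
    (x y : 'rV[R]_n) (t : R) : convex_efun f ->
    f x \is a fin_num -> f y \is a fin_num -> 0 <= t <= 1 ->
  (f (t *: x + (1 - t) *: y)%R
    <= (t * fine (f x) + (1 - t) * fine (f y))%R%:E)%E.
Proof.
move=> cf fx fy t01.
apply: (@convex_set_comb _ _ _ (x, fine (f x) : R^o) (y, fine (f y) : R^o)
  t cf _ _ t01) => /=; by rewrite fineK.
Qed.

Definition convex_on (R : realType) (n : nat) (A : set 'rV[R]_n)
    (phi : 'rV[R]_n -> R) : Prop :=
  forall x y t, A x -> A y -> 0 <= t <= 1 ->
    phi (t *: x + (1 - t) *: y) <= t * phi x + (1 - t) * phi y.

Lemma onem_divSS (R : realType) (K : nat) :
  1 - K.+1%:R / K.+2%:R = K.+2%:R^-1 :> R.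
Proof.
have K2 : K.+2%:R != 0 :> R by rewrite pnatr_eq0.
by rewrite -[X in X - _](mulfV K2) -mulrBl -natrB// subSnn mul1r.
Qed.

(** This two-point form of the average lets Jensen's inequality follow by induction. *)
Lemma outer_outputS (R : realType) (N K : nat) (x : nat -> 'rV[R]_N) :
  outer_output K.+2 x = (K.+1%:R / K.+2%:R) *: outer_output K.+1 x
    + (1 - K.+1%:R / K.+2%:R) *: x K.+2.
Proof.
have K2 : K.+2%:R != 0 :> R by rewrite pnatr_eq0.
have K1 : K.+1%:R != 0 :> R by rewrite pnatr_eq0.
rewrite /outer_output big_nat_recr//= scalerDr scalerA.
congr (_ *: _ + _ *: _); first by rewrite mulrAC mulfV// mul1r.
by rewrite onem_divSS.
Qed.

Lemma outer_output_in (R : realType) (N K : nat) (X : set 'rV[R]_N)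
    (x : nat -> 'rV[R]_N) : convex_set X -> (0 < K)%N ->
  (forall k, (0 < k <= K)%N -> X (x k)) -> X (outer_output K x).
Proof.
case: K => // K cX _; elim: K => [|K IH] hx.
  by rewrite /outer_output big_nat1 invr1 scale1r; exact: hx.
rewrite outer_outputS; apply: convex_set_comb => //.
- by apply: IH => k /andP[k0 kK]; apply: hx; rewrite k0 (leq_trans kK).
- exact: (hx K.+2 (leqnn _)).
- by rewrite divr_ge0//= ler_pdivrMr ?ltr0Sn// mul1r ler_nat.
Qed.

Lemma jensen_outer_output (R : realType) (N K : nat) (X : set 'rV[R]_N)
    (phi : 'rV[R]_N -> R) (x : nat -> 'rV[R]_N) :
    convex_set X -> convex_on _ _ X phi -> (0 < K)%N ->
  (forall k, (0 < k <= K)%N -> X (x k)) ->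
  K%:R * phi (outer_output K x) <= \sum_(1 <= k < K.+1) phi (x k).
Proof.
case: K => // K cX cphi _; elim: K => [|K IH] hx.
  by rewrite /outer_output !big_nat1 invr1 scale1r mul1r.
have hx' k : (0 < k <= K.+1)%N -> X (x k).
  by move=> /andP[k0 kK]; apply: hx; rewrite k0 (leq_trans kK).
rewrite big_nat_recr//= outer_outputS.
apply: le_trans (lerD (IH hx') (lexx _)).
have K2 : 0 < K.+2%:R :> R by rewrite ltr0Sn.
set t := K.+1%:R / K.+2%:R.
have t01 : 0 <= t <= 1.
  by rewrite divr_ge0//= ler_pdivrMr ?ltr0Sn// mul1r ler_nat.
have := cphi _ _ t (outer_output_in _ _ _ _ _ cX (ltn0Sn K) hx')
  (hx K.+2 (leqnn _)) t01.
rewrite -(ler_pM2l K2) => /le_trans; apply.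
suff -> : K.+2%:R * (t * phi (outer_output K.+1 x) + (1 - t) * phi (x K.+2))
  = K.+1%:R * phi (outer_output K.+1 x) + phi (x K.+2) by [].
rewrite onem_divSS mulrDr /t mulrA mulrCA mulfV ?lt0r_neq0// mulr1.
by rewrite mulrA mulfV ?lt0r_neq0// mul1r.
Qed.

(** * Telescoping of the primal-dual gap for real sequences *)

Lemma young_split (R : realType) (L w e a b : R) :
  0 < L -> `|e| <= a + b ->
  w * e <= L * w ^+ 2 + (2 * L)^-1 * (a ^+ 2 + b ^+ 2).
Proof.
move=> L0 eab; apply: le_trans (ler_norm _) _; rewrite normrM.
apply: le_trans (ler_wpM2l (normr_ge0 w) eab) _.
rewrite -(real_normK (num_real w)) -subr_ge0.
have -> : L * `|w| ^+ 2 + (2 * L)^-1 * (a ^+ 2 + b ^+ 2) - `|w| * (a + b) =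
    (2 * L)^-1 * ((L * `|w| - a) ^+ 2 + (L * `|w| - b) ^+ 2).
  by field; rewrite lt0r_neq0.
by rewrite mulr_ge0 ?addr_ge0 ?sqr_ge0// invr_ge0 mulr_ge0// ltW.
Qed.

(** Without clipping this is the three-point identity, an equality. With clipping the new multiplier
    is [0], and [mu >= 0] gives the inequality. *)
Lemma projected_ascent (R : realType) (beta mu l q : R) :
  0 < beta -> 0 <= mu ->
  (mu - Num.max 0 (l + beta * q)) * q <= (2 * beta)^-1 *
    ((mu - l) ^+ 2 - (mu - Num.max 0 (l + beta * q)) ^+ 2
      - (Num.max 0 (l + beta * q) - l) ^+ 2).
Proof.
move=> b0 mu0; rewrite ler_pdivlMl; last by rewrite mulr_gt0.
by case: (lerP 0 (l + beta * q)) => h; nra.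
Qed.

(* One coordinate of the dual update. The inertial term [2 * G - Gp] is traded
   for the telescoping quantity [(mu - l) * (G - Gp)]; the error
   [f' - G' >= 0] of the inexact maximization only costs [theta * mu], since it
   enters with the favourable sign in front of the new multiplier. *)
Lemma dual_step (R : realType) (L beta theta d t mu l f' G' G Gp : R)
    (l' := Num.max 0 (l + beta * (2 * G - Gp))) :
  0 < L -> 0 < beta -> beta <= 1 / (2 * L) -> 0 <= mu ->
  f' - theta <= G' <= f' -> `|G - Gp| <= d * t + theta ->
  (mu - l') * f' <= theta * mu + (mu - l') * (G' - G) - (mu - l) * (G - Gp)
    + (2 * beta)^-1 * ((mu - l) ^+ 2 - (mu - l') ^+ 2)
    + (2 * L)^-1 * (d ^+ 2 * t ^+ 2 + theta ^+ 2).
Proof.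
move=> L0 b0 bL mu0 /andP[G1 G2] hG.
have P := projected_ascent _ beta mu l (2 * G - Gp) b0 mu0.
rewrite -/l' in P.
have Y := young_split _ _ (l' - l) _ _ _ L0 hG.
have l'0 : 0 <= l' by rewrite /l' le_max lexx.
have hL : L <= (2 * beta)^-1.
  rewrite -[L]invrK lef_pV2 ?posrE ?invr_gt0 ?mulr_gt0//.
  by move: bL; rewrite div1r invfM ler_pdivlMl.
have hLq := ler_wpM2r (sqr_ge0 (l' - l)) hL.
rewrite exprMn in Y.
set ib := (2 * beta)^-1 in P hLq *.
set iL := (2 * L)^-1 in Y *.
clearbody ib iL l'.
have : (mu - l') * (f' - G') <= mu * theta.
  by nra.
(* Write [G' = (2 * G - Gp) + (G' - G) - (G - Gp)]. [P] bounds the first product, [Y] bounds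
   [(l' - l) * (G - Gp)], and [hLq] absorbs the resulting [L * (l' - l) ^+ 2]. *)
nra.
Qed.

(** Read [p] as objective values, [a] as squared distances to the comparison point, [t] as step
    lengths and [G] as oracle values; what remains is real arithmetic. *)
Lemma primal_dual_gap (R : realType) (M K : nat) (p a t : nat -> R)
    (f G lam : nat -> 'I_M -> R) (D mu : 'I_M -> R)
    (ps L theta nu alpha beta : R) :
  0 < L -> \sum_(m < M) D m ^+ 2 <= L ^+ 2 ->
  0 < alpha -> alpha <= 1 / L -> 0 < beta -> beta <= 1 / (2 * L) ->
  (forall m, 0 <= mu m) ->
  t 0%N = 0 -> (forall k, 0 <= a k) ->
  (forall m, lam 0%N m = 0) ->
  (forall k m, (k <= K)%N -> f k m - theta <= G k m <= f k m) ->
  (forall k m, (k <= K)%N -> `|G k m - G k.-1 m| <= D m * t k + theta) ->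
  (forall k m, (k < K)%N -> lam k.+1 m =
     Num.max 0 (lam k m + beta * (2 * G k m - G k.-1 m))) ->
  (forall k, (k < K)%N ->
     p k.+1 + \sum_(m < M) lam k.+1 m * f k.+1 m
       <= ps + (2 * alpha)^-1 * (a k - a k.+1 - t k.+1 ^+ 2) + nu) ->
  \sum_(1 <= k < K.+1) (p k + \sum_(m < M) mu m * f k m - ps)
    <= (2 * alpha)^-1 * a 0%N + (2 * beta)^-1 * (\sum_(m < M) mu m ^+ 2)
     + K%:R * (nu + theta * \sum_(m < M) mu m + (2 * L)^-1 * (M%:R * theta ^+ 2))
     + (2 * L)^-1 * (M%:R * theta ^+ 2).
Proof.
move=> L0 DL al0 al b0 bL mu0 t0 a0 lam0 hG hGd hlam hx.
have sumc (c : R) : \sum_(m < M) c = M%:R * c.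
  by rewrite sumr_const card_ord mulr_natl.
have ial : L / 2 <= (2 * alpha)^-1.
  rewrite -[L / 2]invrK lef_pV2 ?posrE ?invr_gt0 ?divr_gt0 ?mulr_gt0//.
  rewrite invf_div mulrC ler_pdivlMr//.
  by move: al; rewrite ler_pdivlMr// => al; nra.
have ibe : L <= (2 * beta)^-1.
  rewrite -[L]invrK lef_pV2 ?posrE ?invr_gt0 ?mulr_gt0//.
  by move: bL; rewrite div1r invfM ler_pdivlMl.
have Dt k : (2 * L)^-1 * (\sum_(m < M) (D m ^+ 2 * t k ^+ 2))
    <= L / 2 * t k ^+ 2.
  rewrite -mulr_suml mulrA ler_wpM2r ?sqr_ge0//.
  apply: le_trans (ler_wpM2l _ DL) _; first by rewrite invr_ge0 mulr_ge0// ltW.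
  by rewrite le_eqVlt; apply/orP; left; apply/eqP; field; rewrite lt0r_neq0.
pose eps := nu + theta * \sum_(m < M) mu m + (2 * L)^-1 * (M%:R * theta ^+ 2).
(* The reserve [- L / 2 * t k ^+ 2] pays for the [D m ^+ 2 * t k ^+ 2] created by the next
   [dual_step]. The inertial sum is the telescoping boundary term, zero at [k = 0] because
   [0.-1 = 0]. *)
have inv k : (k <= K)%N ->
  \sum_(1 <= i < k.+1) (p i + \sum_(m < M) mu m * f i m - ps)
    <= (2 * alpha)^-1 * (a 0%N - a k)
     + (2 * beta)^-1 * (\sum_(m < M) mu m ^+ 2
                        - \sum_(m < M) (mu m - lam k m) ^+ 2)
     - L / 2 * t k ^+ 2
     + \sum_(m < M) (mu m - lam k m) * (G k m - G k.-1 m) + k%:R * eps.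
  elim: k => [_|k IH kK].
    rewrite big_geq// t0 subrr expr0n/= mul0r !mulr0 subr0 add0r addr0.
    rewrite [X in _ - X](eq_bigr (fun m => mu m ^+ 2)); last first.
      by move=> m _; rewrite lam0 subr0.
    rewrite subrr mulr0 add0r big1// => m _.
    by rewrite subrr mulr0.
  rewrite big_nat_recr//=.
  have := IH (ltnW kK).
  set S0 := \sum_(1 <= i < _) _ => hS.
  have hp := hx k kK.
  have hs : \sum_(m < M) (mu m - lam k.+1 m) * f k.+1 m <=
    \sum_(m < M) (theta * mu m + (mu m - lam k.+1 m) * (G k.+1 m - G k m)
      - (mu m - lam k m) * (G k m - G k.-1 m)
      + (2 * beta)^-1 * ((mu m - lam k m) ^+ 2 - (mu m - lam k.+1 m) ^+ 2)
      + (2 * L)^-1 * (D m ^+ 2 * t k ^+ 2 + theta ^+ 2)).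
    apply: ler_sum => m _; rewrite (hlam k m kK).
    apply: dual_step => //; first exact: hG.
    exact: hGd (ltnW kK).
  move: hs; rewrite !big_split /= sumrN -!mulr_sumr sumrB big_split /= sumc.
  have -> : \sum_(m < M) (mu m - lam k.+1 m) * f k.+1 m =
      \sum_(m < M) mu m * f k.+1 m - \sum_(m < M) lam k.+1 m * f k.+1 m.
    by rewrite -sumrB; apply: eq_bigr => m _; rewrite mulrBl.
  have := Dt k.
  have := ler_wpM2r (sqr_ge0 (t k.+1)) ial.
  rewrite -[k.+1%:R]natr1.
  have : eps = nu + theta * \sum_(m < M) mu m
    + (2 * L)^-1 * (M%:R * theta ^+ 2) by [].
  set A1 := \sum_(m < M) (D m ^+ 2 * t k ^+ 2).
  move: hS hp; clearbody eps; lra.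
have hK := inv K (leqnn K).
(* The last boundary term is split by Young's inequality; the quadratic terms in [lam K] and [t K]
   absorb all but the final [theta ^+ 2] term. *)
have Y : \sum_(m < M) (mu m - lam K m) * (G K m - G K.-1 m) <=
  \sum_(m < M) (L * (mu m - lam K m) ^+ 2
    + (2 * L)^-1 * (D m ^+ 2 * t K ^+ 2 + theta ^+ 2)).
  apply: ler_sum => m _; rewrite -exprMn; apply: young_split => //.
  exact: hGd.
move: Y; rewrite big_split /= -!mulr_sumr big_split /= sumc => Y.
have S1 : 0 <= \sum_(m < M) (mu m - lam K m) ^+ 2.
  by apply: sumr_ge0 => m _; rewrite sqr_ge0.
have := ler_wpM2r S1 ibe.
have : 0 <= (2 * alpha)^-1 * a K by rewrite mulr_ge0// invr_ge0 mulr_ge0// ltW.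
move: (Dt K) Y hK; rewrite -/eps; lra.
Qed.

(** * Lipschitz bounds, finiteness and convexity of [maxval] *)

Lemma subdiff_lipschitz (R : realType) (n : nat) (f : 'rV[R]_n -> \bar R)
    (x y xi : 'rV[R]_n) (d : R) :
  f x \is a fin_num -> f y \is a fin_num ->
  subdiff f x xi -> l2norm xi <= d ->
  (f x <= f y + (d * l2norm (x - y))%:E)%E.
Proof.
move=> fx fy /(_ y); rewrite -(fineK fx) -(fineK fy) -!EFinD !lee_fin => h xid.
have := le_trans (cauchy_schwarz _ _ xi (x - y))
  (ler_wpM2r (l2norm_ge0 _ _ _) xid).
have -> : dot xi (x - y) = - dot xi (y - x).
  by rewrite /dot -sumrN; apply: eq_bigr => i _; rewrite !mxE; ring.
by move: h; lra.
Qed.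

Lemma maxval_ub (R : realType) (n j : nat) (Z : set 'rV[R]_j)
    (g : 'rV[R]_n -> 'rV[R]_j -> \bar R) (x : 'rV[R]_n) (z : 'rV[R]_j) :
  Z z -> (g x z <= maxval Z g x)%E.
Proof. by move=> Zz; apply: ereal_sup_ubound; exists z. Qed.

Lemma maxval_leD (R : realType) (n j : nat) (Z : set 'rV[R]_j)
    (g : 'rV[R]_n -> 'rV[R]_j -> \bar R) (x y : 'rV[R]_n) (c : R) :
  (forall z, Z z -> (g x z <= g y z + c%:E)%E) ->
  (maxval Z g x <= maxval Z g y + c%:E)%E.
Proof.
move=> h; apply: ge_ereal_sup => _ [z Zz <-].
by apply: le_trans (h z Zz) _; rewrite leeD2r// maxval_ub.
Qed.

Lemma maxval_fin_num (R : realType) (n j : nat) (Z : set 'rV[R]_j)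
    (g : 'rV[R]_n -> 'rV[R]_j -> \bar R) (x : 'rV[R]_n) :
  Z !=set0 -> (forall z, Z z -> g x z \is a fin_num) ->
  (maxval Z g x < +oo)%E -> maxval Z g x \is a fin_num.
Proof.
move=> [z Zz] gfin foo; rewrite fin_numElt foo andbT.
apply: lt_le_trans (maxval_ub _ _ _ _ _ x z Zz).
by have := gfin z Zz; rewrite fin_numElt => /andP[].
Qed.

(** Near-maximizers stand in for a maximizer; [prox_saddle_bound] lets their error tend to zero. *)
Lemma maxval_approx (R : realType) (n j : nat) (Z : set 'rV[R]_j)
    (g : 'rV[R]_n -> 'rV[R]_j -> \bar R) (x : 'rV[R]_n) (e : R) :
  maxval Z g x \is a fin_num -> (forall z, Z z -> g x z \is a fin_num) ->
  0 < e -> exists2 z, Z z & fine (maxval Z g x) - e <= fine (g x z).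
Proof.
move=> ffin gfin e0.
have [_ [z Zz <-] h] := ub_ereal_sup_adherent e0 ffin.
exists z => //; rewrite -lee_fin fineK ?gfin//.
by rewrite EFinB fineK// ltW.
Qed.

Lemma maxval_convex_on (R : realType) (n j : nat) (X : set 'rV[R]_n)
    (Z : set 'rV[R]_j) (g : 'rV[R]_n -> 'rV[R]_j -> \bar R) :
  convex_set X ->
  (forall x, X x -> maxval Z g x \is a fin_num) ->
  (forall x z, X x -> Z z -> g x z \is a fin_num) ->
  (forall z, Z z -> convex_efun (fun x => g x z)) ->
  convex_on _ _ X (fun x => fine (maxval Z g x)).
Proof.
move=> cX ffin gfin gc x y t Xx Xy t01.
have Xt := convex_set_comb _ _ _ _ _ _ cX Xx Xy t01.
rewrite -lee_fin fineK ?ffin//.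
apply: ge_ereal_sup => _ [z Zz <-].
apply: le_trans (convex_efun_fine _ _ _ _ _ _ (gc z Zz) (gfin _ _ Xx Zz)
  (gfin _ _ Xy Zz) t01) _.
have /andP[t0 t1] := t01.
rewrite lee_fin; apply: lerD; apply: ler_wpM2l; rewrite ?subr_ge0//.
all: by apply: fine_le; rewrite ?gfin ?ffin ?maxval_ub.
Qed.

(** * The saddle inequality and exact penalization *)

(** The saddle inequality is tested at [xs] and at near-maximizers for [x']. Feasibility of [xs] and
    [lam >= 0] make the multiplier sum at [xs] nonpositive. *)
Lemma prox_saddle_bound (R : realType) (N M : nat) (J : 'I_M -> nat)
    (X : set 'rV[R]_N) (Z : forall m, set 'rV[R]_(J m))
    (f0 : 'rV[R]_N -> \bar R)
    (g : forall m, 'rV[R]_N -> 'rV[R]_(J m) -> \bar R)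
    (alpha nu : R) (lam : 'rV[R]_M) (xk x' xs : 'rV[R]_N)
    (zt : forall m, 'rV[R]_(J m)) :
  (forall m, 0 <= lam 0 m) ->
  (forall m x, X x -> maxval (Z m) (g m) x \is a fin_num) ->
  (forall m x z, X x -> Z m z -> g m x z \is a fin_num) ->
  X xs -> (forall m, (maxval (Z m) (g m) xs <= 0)%E) ->
  strong_approx_saddle X [set w | forall m, Z m (w m)]
    (prox_lagrangian f0 g alpha lam xk) alpha^-1 nu x' zt ->
  fine (f0 x') + \sum_(m < M) lam 0 m * fine (maxval (Z m) (g m) x')
    <= fine (f0 xs) + (2 * alpha)^-1 *
         (l2norm (xs - xk) ^+ 2 - l2norm (xs - x') ^+ 2 - l2norm (x' - xk) ^+ 2)
       + nu.
Proof.
move=> lam0 ffin gfin Xxs fxs [Xx' Zzt sad].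
apply/ler_addgt0Pr => e e0.
have S0 : 0 <= \sum_(m < M) lam 0 m by apply: sumr_ge0.
(* This makes the total weighted error at most [e]; the added [1] keeps the denominator positive. *)
pose d := e / (1 + \sum_(m < M) lam 0 m).
have d0 : 0 < d by rewrite divr_gt0// ltr_pwDl.
have near m : {z | Z m z & fine (maxval (Z m) (g m) x') - d <= fine (g m x' z)}.
  by apply: cid2; apply: maxval_approx => // [|z Zz]; [exact: ffin|exact: gfin].
have := sad xs (fun m => s2val (near m)) Xxs (fun m => s2valP (near m)).
rewrite /prox_lagrangian.
have h1 : \sum_(m < M) lam 0 m * fine (maxval (Z m) (g m) x') - e <=
    \sum_(m < M) lam 0 m * fine (g m x' (s2val (near m))).
  have : \sum_(m < M) lam 0 m * (fine (maxval (Z m) (g m) x') - d) <=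
    \sum_(m < M) lam 0 m * fine (g m x' (s2val (near m))).
    by apply: ler_sum => m _; apply: ler_wpM2l => //; exact: (s2valP' (near m)).
  apply: le_trans; rewrite (eq_bigr _ (fun m _ => mulrBr _ _ _)) sumrB lerD2l.
  rewrite lerN2 -mulr_suml /d mulrCA ger_pMr// ler_pdivrMr ?ltr_pwDl//.
  by rewrite mul1r lerDr.
have h2 : \sum_(m < M) lam 0 m * fine (g m xs (zt m)) <= 0.
  apply: sumr_le0 => m _; apply: mulr_ge0_le0 => //.
  apply: fine_le0; apply: le_trans (fxs m).
  by apply: maxval_ub; exact: Zzt.
rewrite -[alpha^-1 / 2]mulrC -invfM.
by move: h1 h2; lra.
Qed.

(* Moving from [x] towards a Slater point until feasibility is reached costs
   at most a multiple of the violation [v]; this exact-penalty bound replaces an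
   optimal dual multiplier. *)
Lemma slater_exact_penalty (R : realType) (N M : nat) (X : set 'rV[R]_N)
    (phi0 : 'rV[R]_N -> R) (phi : 'I_M -> 'rV[R]_N -> R)
    (xb xs x : 'rV[R]_N) (s v : R) :
  convex_set X -> convex_on _ _ X phi0 ->
  (forall m, convex_on _ _ X (phi m)) ->
  X xb -> 0 < s -> (forall m, phi m xb <= - s) ->
  (forall y, X y -> (forall m, phi m y <= 0) -> phi0 xs <= phi0 y) ->
  X x -> 0 <= v -> (forall m, phi m x <= v) ->
  phi0 xs - phi0 x <= (phi0 xb - phi0 xs) / s * v.
Proof.
move=> cX c0 c Xxb s0 xbs opt Xx v0 xv.
have sv : 0 < s + v by rewrite ltr_pwDl.
(* This weight solves [t * v - (1 - t) * s = 0], so convexity makes the combined point feasible. *)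
pose t := s / (s + v).
have t01 : 0 <= t <= 1.
  by rewrite divr_ge0 ?(ltW s0) ?(ltW sv)//= ler_pdivrMr// mul1r lerDl.
have tE : 1 - t = v / (s + v) by rewrite /t; field; rewrite lt0r_neq0.
have Xt := convex_set_comb _ _ _ _ _ _ cX Xx Xxb t01.
have : phi0 xs <= t * phi0 x + (1 - t) * phi0 xb.
  apply: le_trans (c0 _ _ _ Xx Xxb t01); apply: opt => // m.
  apply: le_trans (c m _ _ _ Xx Xxb t01) _.
  have /andP[t0 t1] := t01.
  apply: (@le_trans _ _ (t * v + (1 - t) * - s)).
    by apply: lerD; apply: ler_wpM2l; rewrite ?subr_ge0.
  by rewrite tE /t le_eqVlt; apply/orP; left; apply/eqP; ring.
rewrite tE /t -(ler_pM2l sv).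
have -> : (s + v) * (s / (s + v) * phi0 x + v / (s + v) * phi0 xb) =
    s * phi0 x + v * phi0 xb by field; rewrite lt0r_neq0.
move=> h; rewrite mulrAC ler_pdivlMr//.
by move: h; lra.
Qed.

Lemma convex_on_lagrangian (R : realType) (N M : nat) (X : set 'rV[R]_N)
    (phi0 : 'rV[R]_N -> R) (phi : 'I_M -> 'rV[R]_N -> R) (mu : 'I_M -> R)
    (c : R) :
  convex_on _ _ X phi0 -> (forall m, convex_on _ _ X (phi m)) ->
  (forall m, 0 <= mu m) ->
  convex_on _ _ X (fun x => phi0 x + \sum_(m < M) mu m * phi m x - c).
Proof.
move=> c0 cphi mu0 x y t Xx Xy t01.
have h : \sum_(m < M) mu m * phi m (t *: x + (1 - t) *: y) <=
    t * \sum_(m < M) mu m * phi m x + (1 - t) * \sum_(m < M) mu m * phi m y.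
  rewrite !mulr_sumr -big_split /=; apply: ler_sum => m _.
  apply: le_trans (ler_wpM2l (mu0 m) (cphi m x y t Xx Xy t01)) _.
  by rewrite mulrDr !(mulrCA (mu m)).
by move: (c0 x y t Xx Xy t01) h; lra.
Qed.

(** * From runs of the algorithm to the gap bound *)

Lemma outer_run_in (R : realType) (N M : nat) (J : 'I_M -> nat)
    (X : set 'rV[R]_N) (Z : forall m, set 'rV[R]_(J m))
    (f0 : 'rV[R]_N -> \bar R)
    (g : forall m, 'rV[R]_N -> 'rV[R]_(J m) -> \bar R)
    (K : nat) (theta nu alpha beta : R) (x : nat -> 'rV[R]_N)
    (z zt : nat -> forall m, 'rV[R]_(J m)) (lam : nat -> 'rV[R]_M) :
  outer_run X Z f0 g K theta nu alpha beta x z zt lam ->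
  forall k, (k <= K)%N -> X (x k).
Proof.
move=> [_ X0 _ _ hx] [//|k] kK.
by have [] := hx k kK.
Qed.

Lemma outer_run_gap (R : realType) (N M : nat) (J : 'I_M -> nat)
    (X : set 'rV[R]_N) (Z : forall m, set 'rV[R]_(J m))
    (f0 : 'rV[R]_N -> \bar R)
    (g : forall m, 'rV[R]_N -> 'rV[R]_(J m) -> \bar R)
    (xs : 'rV[R]_N) (D : 'I_M -> R) (L alpha beta theta nu : R) (K : nat)
    (x : nat -> 'rV[R]_N) (z zt : nat -> forall m, 'rV[R]_(J m))
    (lam : nat -> 'rV[R]_M) (mu : 'I_M -> R)
    (phi := fun m y => fine (maxval (Z m) (g m) y)) :
  0 < L -> \sum_(m < M) D m ^+ 2 <= L ^+ 2 ->
  0 < alpha -> alpha <= 1 / L -> 0 < beta -> beta <= 1 / (2 * L) ->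
  0 <= theta ->
  (forall m y, X y -> maxval (Z m) (g m) y \is a fin_num) ->
  (forall m y w, X y -> Z m w -> g m y w \is a fin_num) ->
  (forall m y y', X y -> X y' -> phi m y <= phi m y' + D m * l2norm (y - y')) ->
  X xs -> (forall m, (maxval (Z m) (g m) xs <= 0)%E) ->
  (forall m, 0 <= mu m) ->
  outer_run X Z f0 g K theta nu alpha beta x z zt lam ->
  \sum_(1 <= k < K.+1)
      (fine (f0 (x k)) + \sum_(m < M) mu m * phi m (x k) - fine (f0 xs))
    <= (2 * alpha)^-1 * l2norm (xs - x 0%N) ^+ 2
     + (2 * beta)^-1 * (\sum_(m < M) mu m ^+ 2)
     + K%:R * (nu + theta * \sum_(m < M) mu m + (2 * L)^-1 * (M%:R * theta ^+ 2))
     + (2 * L)^-1 * (M%:R * theta ^+ 2).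
Proof.
move=> L0 DL al0 al b0 bL th0 ffin gfin lip Xxs fxs mu0 run.
have Xk := outer_run_in _ _ _ _ _ _ _ _ _ _ _ _ _ _ _ _ _ run.
have [lam0 _ hz hlam hx] := run.
(* The algorithm does not call the oracle at the last index [K]. *)
pose G k m := if (k < K)%N then fine (g m (x k) (z k m)) else phi m (x k).
have hG k m : (k <= K)%N -> phi m (x k) - theta <= G k m <= phi m (x k).
  move=> kK; rewrite /G; case: ifP => kK'; last by rewrite lexx andbT gerBl.
  have [Zz] := hz k m kK'; have Xx := Xk k kK.
  have gf := gfin m _ _ Xx Zz; have ff := ffin m _ Xx.
  rewrite -(fineK gf) -(fineK ff) -EFinB lee_fin => h.
  rewrite lerBlDr -lerBlDl h /=.
  by apply: fine_le => //; apply: maxval_ub.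
apply: (@primal_dual_gap _ _ _ (fun k => fine (f0 (x k)))
  (fun k => l2norm (xs - x k) ^+ 2) (fun k => l2norm (x k - x k.-1))
  (fun k m => phi m (x k)) G (fun k m => lam k 0 m) D mu) => //.
- by rewrite subrr l2norm0.
- by move=> k; rewrite sqr_ge0.
- by move=> m; rewrite lam0 mxE.
(* Both values [G] lie in an interval of length [theta] below [phi], so their difference costs one
   [theta], not two. *)
- move=> k m kK.
  have kK' : (k.-1 <= K)%N by exact: leq_trans (leq_pred k) kK.
  have /andP[a1 a2] := hG k m kK; have /andP[b1 b2] := hG _ m kK'.
  have l1 := lip m _ _ (Xk _ kK) (Xk _ kK').
  have l2 := lip m _ _ (Xk _ kK') (Xk _ kK).
  rewrite l2norm_sub in l2.
  by rewrite ler_norml; apply/andP; split; move: l1 l2 a1 a2 b1 b2; lra.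
- move=> k m kK; rewrite hlam// mxE /G kK.
  by rewrite (leq_ltn_trans (leq_pred k) kK).
- move=> k kK; apply: (prox_saddle_bound _ _ _ _ X Z f0 g) (hx k kK) => //.
  by move=> m; rewrite hlam// mxE le_max lexx.
Qed.

Theorem theorem1 (R : realType) (N M : nat) (J : 'I_M -> nat)
    (X : set 'rV[R]_N) (Z : forall m, set 'rV[R]_(J m))
    (f0 : 'rV[R]_N -> \bar R)
    (g : forall m, 'rV[R]_N -> 'rV[R]_(J m) -> \bar R)
    (xs : 'rV[R]_N) (D0 : R) (D E : 'I_M -> R) (alpha beta : R)
    (hM : (0 < M)%N)
    (hX0 : X !=set0) (hXc : compact X) (hXconv : convex_set X)
    (hZ0 : forall m, Z m !=set0) (hZc : forall m, compact (Z m))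
    (hZconv : forall m, convex_set (Z m))
    (hf0 : forall x, f0 x != -oo%E)
    (hf0conv : convex_efun f0)
    (hf0dom : forall x, X x -> f0 x \is a fin_num)
    (hgconv : forall m z, Z m z -> convex_efun (fun x => g m x z))
    (hgconc : forall m x, X x -> concave_efun (g m x))
    (hgdom : forall m x z, X x -> Z m z -> g m x z \is a fin_num)
    (hslater : exists2 xb, X xb & forall m, (maxval (Z m) (g m) xb < 0)%E)
    (hopt : optimal_solution X f0 (fun m => maxval (Z m) (g m)) xs)
    (hf0sub : forall x, X x -> subdiff f0 x !=set0)
    (hgsubx : forall m x z, X x -> Z m z ->
      subdiff (fun y => g m y z) x !=set0)
    (hgsubz : forall m x z, X x -> Z m z ->
      subdiff (fun w => (- g m x w)%E) z !=set0)
    (hD0 : 0 < D0) (hD : forall m, 0 < D m) (hE : forall m, 0 < E m)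
    (hf0bnd : forall x xi, X x -> subdiff f0 x xi -> l2norm xi <= D0)
    (hgbndx : forall m x z xi, X x -> Z m z ->
      subdiff (fun y => g m y z) x xi -> l2norm xi <= D m)
    (hgbndz : forall m x z zeta, X x -> Z m z ->
      subdiff (fun w => (- g m x w)%E) z zeta -> l2norm zeta <= E m)
    (halpha0 : 0 < alpha)
    (halpha : alpha <= 1 / Num.sqrt (\sum_(m < M) D m ^+ 2))
    (hbeta0 : 0 < beta)
    (hbeta : beta <= 1 / (2 * Num.sqrt (\sum_(m < M) D m ^+ 2))) :
  exists C1 C2 : R, [/\ 0 < C1, 0 < C2 &
    forall (K : nat) (x : nat -> 'rV[R]_N)
      (z zt : nat -> forall m, 'rV[R]_(J m)) (lam : nat -> 'rV[R]_M),
      (1 <= K)%N ->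
      outer_run X Z f0 g K (1 / K%:R) (1 / K%:R) alpha beta x z zt lam ->
      (f0 (outer_output K x) - f0 xs <= (C1 / K%:R)%:E)%E /\
      (\big[maxe/0%E]_(m < M) maxe (maxval (Z m) (g m) (outer_output K x)) 0%E
         <= (C2 / K%:R)%:E)%E].
Proof.
have [xb Xxb slb] := hslater.
have [[Xxs fxs] opt] := hopt.
pose phi0 y := fine (f0 y).
pose phi m y := fine (maxval (Z m) (g m) y).
pose L := Num.sqrt (\sum_(m < M) D m ^+ 2).
(* [hM] supplies a positive summand; an empty sum would give [L = 0]. *)
have L0 : 0 < L.
  rewrite sqrtr_gt0 (bigD1 (Ordinal hM))//= ltr_pwDl ?exprn_gt0//.
  by apply: sumr_ge0 => m _; rewrite sqr_ge0.
have DL : \sum_(m < M) D m ^+ 2 <= L ^+ 2.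
  by rewrite sqr_sqrtr// sumr_ge0// => m _; rewrite sqr_ge0.
have lipE m y y' : X y -> X y' ->
    (maxval (Z m) (g m) y <= maxval (Z m) (g m) y'
                            + (D m * l2norm (y - y'))%:E)%E.
  move=> Xy Xy'; apply: maxval_leD => w Zw.
  have [xi hxi] := hgsubx m y w Xy Zw.
  apply: (subdiff_lipschitz _ _ (fun u => g m u w) _ _ xi) => //.
  - exact: hgdom.
  - exact: hgdom.
  - exact: (hgbndx m y w).
(* The Lipschitz bound in extended reals compares [y] with the Slater point, where the value is
   negative and so below [+oo]. *)
have ffin m y : X y -> maxval (Z m) (g m) y \is a fin_num.
  move=> Xy; apply: maxval_fin_num => // [w Zw|]; first exact: hgdom.
  apply: le_lt_trans (lipE m y xb Xy Xxb) _.
  by rewrite lte_add_pinfty ?ltry// (lt_trans (slb m))// ltry.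
have lip m y y' : X y -> X y' -> phi m y <= phi m y' + D m * l2norm (y - y').
  by move=> Xy Xy'; rewrite -lee_fin EFinD !fineK ?ffin// lipE.
have c0 : convex_on _ _ X phi0.
  move=> y y' t Xy Xy' t01; rewrite -lee_fin fineK.
    by apply: convex_efun_fine => //; apply: hf0dom.
  by apply: hf0dom; apply: convex_set_comb.
have cphi m : convex_on _ _ X (phi m).
  apply: maxval_convex_on => //.
  - by move=> y; exact: ffin.
  - by move=> y w; exact: hgdom.
  - by move=> w; exact: hgconv.
(* A Slater margin common to all constraints, capped at [1] by the initial value of the minimum. *)
pose s := \big[Num.min/1]_(m < M) - phi m xb.
have s0 : 0 < s.
  apply/bigmin_gtP; split => // m _.
  by rewrite oppr_gt0 -lte_fin fineK ?ffin.
have xbs m : phi m xb <= - s by rewrite lerNr bigmin_le.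
have optR y : X y -> (forall m, phi m y <= 0) -> phi0 xs <= phi0 y.
  move=> Xy fy; apply: fine_le; rewrite ?hf0dom//.
  by apply: opt; split => // m; rewrite -(fineK (ffin m y Xy)) lee_fin; exact: fy.
have [B B0 hB] := compact_dist_bounded _ _ X xs hXc.
pose rho := (phi0 xb - phi0 xs) / s.
have rho0 : 0 <= rho.
  rewrite divr_ge0 ?(ltW s0)// subr_ge0 optR// => m.
  by rewrite (le_trans (xbs m))// oppr_le0 ltW.
(* In [c1], the [1] is [K * nu] and [M / L] covers both [theta ^+ 2] terms. [c2] is the additional
   cost of a [mu] with single nonzero entry [rho + 1]. *)
pose c1 := (2 * alpha)^-1 * B + 1 + M%:R / L.
pose c2 := (2 * beta)^-1 * (rho + 1) ^+ 2 + (rho + 1).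
have c10 : 0 < c1.
  rewrite /c1 ltr_wpDr ?divr_ge0 ?(ltW L0)// ltr_wpDl//.
  by rewrite mulr_ge0// invr_ge0 mulr_ge0// ltW.
have c20 : 0 < c2.
  rewrite /c2 ltr_wpDl ?ltr_wpDl//.
  by rewrite mulr_ge0 ?sqr_ge0// invr_ge0 mulr_ge0// ltW.
exists c1, (c1 + c2); split; [by []|exact: addr_gt0|].
move=> K x z zt lam K1 run.
have K0 : 0 < K%:R :> R by rewrite ltr0n.
have Xx := outer_run_in _ _ _ _ _ _ _ _ _ _ _ _ _ _ _ _ _ run.
have Xx1 k : (0 < k <= K)%N -> X (x k) by move=> /andP[_]; exact: Xx.
set xo := outer_output K x.
have Xxo : X xo by exact: outer_output_in Xx1.
have key mu : (forall m, 0 <= mu m) ->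
    K%:R * (phi0 xo + \sum_(m < M) mu m * phi m xo - phi0 xs)
      <= c1 + (2 * beta)^-1 * (\sum_(m < M) mu m ^+ 2) + \sum_(m < M) mu m.
  move=> mu0.
  have th0 : 0 <= 1 / K%:R :> R by rewrite divr_ge0.
  have gap := outer_run_gap _ _ _ _ X Z f0 g xs D L alpha beta _ _ K
    x z zt lam mu L0 DL halpha0 halpha hbeta0 hbeta th0 ffin hgdom lip Xxs fxs
    mu0 run.
  have := jensen_outer_output _ _ _ X _ x hXconv
    (convex_on_lagrangian _ _ _ X phi0 phi mu (phi0 xs) c0 cphi mu0) K1 Xx1.
  move=> /le_trans; apply; apply: le_trans gap _.
  have hB0 : (2 * alpha)^-1 * l2norm (xs - x 0%N) ^+ 2 <= (2 * alpha)^-1 * B.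
    by rewrite ler_wpM2l ?hB// ?invr_ge0 ?mulr_ge0 ?(ltW halpha0)//; exact: Xx.
  (* The two [theta ^+ 2] terms become [q / K] and [q / K ^ 2], each at most [q]. *)
  pose q := (2 * L)^-1 * M%:R.
  have q0 : 0 <= q by rewrite mulr_ge0// invr_ge0 mulr_ge0// ltW.
  have qE : M%:R / L = q + q by rewrite /q; field; rewrite lt0r_neq0.
  have ik1 : K%:R^-1 <= 1 :> R by rewrite invf_le1// ler1n.
  have ik2 : K%:R^-1 ^+ 2 <= 1 :> R by rewrite expr_le1// invr_ge0.
  rewrite !mul1r.
  have -> : K%:R * (K%:R^-1 + K%:R^-1 * (\sum_(m < M) mu m)
      + (2 * L)^-1 * (M%:R * K%:R^-1 ^+ 2))
      = 1 + \sum_(m < M) mu m + q * K%:R^-1.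
    by rewrite /q; field; rewrite !lt0r_neq0.
  have := ler_wpM2l q0 ik1; have := ler_wpM2l q0 ik2.
  rewrite [(2 * L)^-1 * _]mulrA -/q /c1 qE mulr1; move: hB0; clearbody q.
  by lra.
split.
  rewrite -(fineK (hf0dom _ Xxo)) -(fineK (hf0dom _ Xxs)) -EFinB lee_fin.
  rewrite ler_pdivlMr// mulrC.
  have := key (fun=> 0) (fun=> lexx _).
  rewrite !big1 ?mulr0 ?addr0// => m _; rewrite ?mul0r ?expr0n//.
have [m0 _ hm0] := @arg_maxP _ _ _ (Ordinal hM) xpredT (phi^~ xo) isT.
have v_le : phi m0 xo <= (c1 + c2) / K%:R.
  have [v0|v0] := lerP (phi m0 xo) 0.
    by rewrite (le_trans v0)// divr_ge0// addr_ge0// ltW.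
  pose mu m := if m == m0 then rho + 1 else 0 : R.
  have mu0 m : 0 <= mu m by rewrite /mu; case: ifP => // _; rewrite addr_ge0.
  (* The function [h] covers both [mu] and its square, so one computation evaluates all three
     sums. *)
  have muE (h : R -> R) (w : 'I_M -> R) : h 0 = 0 ->
      \sum_(m < M) h (mu m) * w m = h (rho + 1) * w m0.
    move=> h0; rewrite (bigD1 m0)//= /mu eqxx big1 ?addr0// => m /negbTE ->.
    by rewrite h0 mul0r.
  have := key mu mu0.
  have -> : \sum_(m < M) mu m ^+ 2 = (rho + 1) ^+ 2.
    under eq_bigr do rewrite -[_ ^+ 2]mulr1.
    by rewrite (muE (fun r => r ^+ 2) (fun=> 1)) ?mulr1// expr0n.
  have -> : \sum_(m < M) mu m = rho + 1.
    under eq_bigr do rewrite -[mu _]mulr1.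
    by rewrite (muE id (fun=> 1)) ?mulr1.
  rewrite (muE id (phi^~ xo))//.
  have := slater_exact_penalty _ _ _ X phi0 phi xb xs xo s _ hXconv c0 cphi
    Xxb s0 xbs optR Xxo (ltW v0) (fun m => hm0 m isT).
  rewrite -/rho ler_pdivlMr// => pen h.
  (* By [pen] the objective falls below optimal by at most [rho] times the violation, so the weight
     [rho + 1] leaves one full copy of it. *)
  have : K%:R * phi m0 xo <= K%:R * (phi0 xo + (rho + 1) * phi m0 xo - phi0 xs).
    by rewrite ler_pM2l//; move: pen; lra.
  by move=> /le_trans /(_ h) h'; rewrite mulrC /c2 addrA.
(* Nonnegativity of the bound handles both the initial value [0] of the maximum and the positive
   part. *)
apply: bigmax_le => [|m _].
  by rewrite lee_fin divr_ge0// ltW// addr_gt0.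
rewrite ge_max lee_fin divr_ge0 ?(ltW (addr_gt0 c10 c20))// andbT.
rewrite -(fineK (ffin m _ Xxo)) lee_fin.
by apply: le_trans (hm0 m isT) v_le.
Qed.
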